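(* Let $A \in \mathbb{R}^{n \times n}$ be Metzler and $B = e_k b^T$ for some $b \in \mathbb{R}^n$ and some $k \in \{1, \ldots, n\}$. Then $(A,B)$ is diagonally Riccati stable if and only if $\hat A + \bar B$ is Hurwitz.
   Context: $M \succ 0$ ($M \prec 0$) means that the real matrix $M=M^T$ is positive definite (negative definite). A pair $(A,B)$ of matrices in $\mathbb{R}^{n\times n}$ is diagonally Riccati stable if there exist diagonal $P \succ 0$, $Q \succ 0$ in $\mathbb{R}^{n \times n}$ with $A^TP+PA + Q + PBQ^{-1}B^TP \prec 0$. $A\in\mathbb{R}^{n\times n}$ is Metzler if $a_{ij}\ge 0$ for all $i \neq j$. A real square matrix is Hurwitz if all its eigenvalues have negative real part. $e_1,\dots,e_n$ is the standard basis of $\mathbb{R}^n$. For $C \in \mathbb{R}^{n\times n}$, $\hat C$ is the matrix with $\hat c_{ii}=c_{ii}$ and $\hat c_{ij}=|c_{ij}|$ for $i\neq j$, and $\bar C$ is the matrix with $\bar c_{ij}=|c_{ij}|$ for all $i,j$. *)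

(* Defs.v *)
From HB Require Import structures.
From mathcomp Require Import all_boot all_order all_algebra.
From mathcomp Require Import reals complex.

Set Implicit Arguments.
Unset Strict Implicit.
Unset Printing Implicit Defensive.

Import Order.TTheory GRing.Theory Num.Theory.
Local Open Scope ring_scope.

(* Symmetry is part of definiteness. *)
Definition posdefmx (R : realType) (n : nat) (M : 'M[R]_n) : Prop :=
  M^T = M /\ forall x : 'cV[R]_n, x != 0 -> 0 < (x^T *m M *m x) 0 0.

Definition negdefmx (R : realType) (n : nat) (M : 'M[R]_n) : Prop :=
  M^T = M /\ forall x : 'cV[R]_n, x != 0 -> (x^T *m M *m x) 0 0 < 0.

Definition diagonally_Riccati_stable (R : realType) (n : nat)
    (A B : 'M[R]_n) : Prop :=
  exists P Q : 'M[R]_n,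
    [/\ is_diag_mx P, posdefmx P, is_diag_mx Q, posdefmx Q &
        negdefmx (A^T *m P + P *m A + Q + P *m B *m invmx Q *m B^T *m P)].

Definition Metzler (R : realType) (n : nat) (A : 'M[R]_n) : Prop :=
  forall i j : 'I_n, i != j -> 0 <= A i j.

(* The eigenvalues are those of M viewed as a complex matrix. *)
Definition Hurwitz (R : realType) (n : nat) (M : 'M[R]_n) : Prop :=
  forall z : R[i],
    eigenvalue (map_mx (real_complex R) M) z -> complex.Re z < 0.

Definition hatmx (R : realType) (n : nat) (C : 'M[R]_n) : 'M[R]_n :=
  \matrix_(i, j) (if i == j then C i j else `|C i j|).

Definition barmx (R : realType) (n : nat) (C : 'M[R]_n) : 'M[R]_n :=
  \matrix_(i, j) `|C i j|.

(* Main.v *)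
Require Import Defs.
From mathcomp Require Import all_boot all_order all_algebra.
From mathcomp Require Import reals.
From mathcomp Require Import complex polyrcf ring lra.

Import Order.TTheory GRing.Theory Num.Theory.

Local Open Scope ring_scope.

(** Since A is Metzler, the comparison matrix is N = A + e_k |b|^T, again
    Metzler.  Because B has rank one, the term P B Q^-1 B^T P of the Riccati
    matrix S collapses to c e_k e_k^T with c = p_k^2 \sum_l b_l^2 / q_l, so only
    the moduli |b_l| matter.

    Stability implies Hurwitz: by the arithmetic-geometric mean inequality,
    2 (p_k x_k) |b_l| x_l <= q_l x_l^2 + (p_k x_k)^2 b_l^2 / q_l.  Summed over l
    this says that N^T P + P N <= S as quadratic forms, so N^T P + P N is
    negative definite and N is Hurwitz by Lyapunov's theorem
    (Lyapunov_Hurwitz).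

    Hurwitz implies stability: a Metzler Hurwitz matrix maps some positive
    vector to a negative one (Metzler_Hurwitz_posvec).  Take positive v, w with
    N v < 0 and N^T w < 0, set p_i = w_i / v_i, so that P v = w, and choose q_i
    to make the above inequality an equality at x = v, that is
    q_i v_i = |b_i| w_k.  Then S v = N^T w + P N v < 0.  As S is symmetric and
    Metzler, S v < 0 for a positive v forces S to be negative definite
    (Metzler_posvec_negdef).  Where b_i = 0 the recipe would give q_i = 0; there
    the slack -(N^T w)_i > 0 serves instead, and S v < 0 survives since P N v < 0
    strictly. *)

(** * Diagonal matrices, rank-one matrices and their quadratic forms *)

Lemma diag_quadform {R : comNzRingType} {n : nat} (d : 'rV[R]_n) (x : 'cV[R]_n) :
  (x^T *m diag_mx d *m x) 0 0 = \sum_i d 0 i * x i 0 ^+ 2.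
Proof.
rewrite mul_mx_diag mxE; apply: eq_bigr => i _.
by rewrite !mxE expr2 mulrA [_ * d _ _]mulrC.
Qed.

Lemma rank1_quadform {R : comNzRingType} {n : nat} (u v x : 'cV[R]_n) :
  (x^T *m (u *m v^T) *m x) 0 0 = (u^T *m x) 0 0 * (v^T *m x) 0 0.
Proof.
rewrite mulmxA -mulmxA mxE big_ord1; congr (_ * _).
by rewrite -[x^T *m u]trmxK trmx_mul trmxK mxE.
Qed.

Lemma mul_diag_delta {R : comNzRingType} {n : nat} (d : 'rV[R]_n) (k : 'I_n) :
  diag_mx d *m delta_mx k 0 = d 0 k *: delta_mx k 0 :> 'cV[R]_n.
Proof.
apply/colP => i; rewrite mul_diag_mx !mxE eqxx andbT.
by have [->|] := eqVneq i k => //; rewrite !mulr0.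
Qed.

Lemma diag_mulE {R : comNzRingType} {n : nat} (d : 'rV[R]_n) (x : 'cV[R]_n)
    (i : 'I_n) :
  (diag_mx d *m x) i 0 = d 0 i * x i 0.
Proof. by rewrite mul_diag_mx mxE. Qed.

Lemma delta_trmulE {R : comNzRingType} {n : nat} (k : 'I_n) (x : 'cV[R]_n) :
  ((delta_mx k 0 : 'cV[R]_n)^T *m x) 0 0 = x k 0.
Proof.
rewrite mxE (bigD1 k) //= big1 => [|j jk]; rewrite !mxE eqxx ?andbT.
  by rewrite mul1r addr0.
by rewrite (negPf jk) mul0r.
Qed.

Lemma norm_trmulE {R : numDomainType} {n : nat} (b x : 'cV[R]_n) :
  ((map_mx Num.norm b)^T *m x) 0 0 = \sum_l `|b l 0| * x l 0.
Proof. by rewrite mxE; apply: eq_bigr => l _; rewrite !mxE. Qed.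

Lemma diag_posdefmxP (R : realType) (n : nat) (d : 'rV[R]_n) :
  posdefmx (diag_mx d) <-> forall i, 0 < d 0 i.
Proof.
split=> [[_ hpos] i|hd].
  have /hpos : delta_mx i 0 != 0 :> 'cV[R]_n.
    by apply/negP => /eqP/matrixP/(_ i 0)/eqP; rewrite !mxE !eqxx oner_eq0.
  rewrite diag_quadform (bigD1 i) //= big1 => [|j ji].
    by rewrite !mxE !eqxx expr1n mulr1 addr0.
  by rewrite !mxE (negPf ji) expr0n mulr0.
split=> [|x xN0]; first by rewrite tr_diag_mx.
rewrite diag_quadform.
have sq_ge0 i : 0 <= d 0 i * x i 0 ^+ 2.
  by rewrite mulr_ge0 ?sqr_ge0 ?ltW.
rewrite lt_neqAle sumr_ge0 // andbT eq_sym; apply: contra xN0 => /eqP s0.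
apply/eqP/colP => i; rewrite mxE.
have /(_ i isT)/eqP := psumr_eq0P (fun i _ => sq_ge0 i) s0.
by rewrite mulf_eq0 gt_eqF //= sqrf_eq0 => /eqP.
Qed.

(** Off the diagonal, x_i x_j <= (y_i v_j + y_j v_i) / 2 with y_i = x_i^2 / v_i;
    on the diagonal this is an equality, so the sign of S_ii is irrelevant.
    By symmetry of S the resulting bound on x^T S x is \sum_i y_i (S v)_i,
    whose terms are nonpositive and vanish only where x does. *)
Lemma Metzler_posvec_negdef {R : realType} {n : nat} {S : 'M[R]_n}
    {v : 'cV[R]_n} :
    S^T = S -> Metzler S -> (forall i, 0 < v i 0) ->
    (forall i, (S *m v) i 0 < 0) ->
  negdefmx S.
Proof.
move=> symS metS v_gt0 Sv_lt0; split=> // x xN0.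
have Ssym i j : S i j = S j i by rewrite -[in LHS]symS mxE.
pose y i := x i 0 ^+ 2 / v i 0.
have le_y : (x^T *m S *m x) 0 0 <= \sum_i y i * (S *m v) i 0.
  have -> : (x^T *m S *m x) 0 0 = \sum_i \sum_j S i j * (x i 0 * x j 0).
    rewrite -mulmxA mxE; apply: eq_bigr => i _.
    rewrite mxE mxE mulr_sumr; apply: eq_bigr => j _; ring.
  have -> : \sum_i y i * (S *m v) i 0 =
      \sum_i \sum_j S i j * ((y i * v j 0 + y j * v i 0) / 2).
    have e1 : \sum_i y i * (S *m v) i 0 = \sum_i \sum_j S i j * (y i * v j 0).
      apply: eq_bigr => i _; rewrite mxE mulr_sumr; apply: eq_bigr => j _; ring.
    have e2 : \sum_i y i * (S *m v) i 0 = \sum_i \sum_j S i j * (y j * v i 0).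
      rewrite e1 exchange_big /=; apply: eq_bigr => i _; apply: eq_bigr => j _.
      by rewrite Ssym.
    have -> : \sum_i \sum_j S i j * ((y i * v j 0 + y j * v i 0) / 2) =
       (\sum_i \sum_j S i j * (y i * v j 0) +
        \sum_i \sum_j S i j * (y j * v i 0)) / 2.
      rewrite -big_split mulr_suml; apply: eq_bigr => i _ /=.
      rewrite -big_split mulr_suml; apply: eq_bigr => j _ /=; ring.
    rewrite -e1 -e2; lra.
  apply: ler_sum => i _; apply: ler_sum => j _.
  have vi := v_gt0 i; have vj := v_gt0 j.
  have [<-|ij] := eqVneq i j.
    suff -> : (y i * v i 0 + y i * v i 0) / 2 = x i 0 * x i 0 by [].
    by rewrite /y; field; rewrite gt_eqF.
  apply: ler_wpM2l; first exact: (metS i j ij).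
  rewrite -subr_ge0 (_ : _ - _ =
    (x i 0 * v j 0 - x j 0 * v i 0) ^+ 2 / (2 * v i 0 * v j 0)).
    by rewrite divr_ge0 ?sqr_ge0 // !mulr_ge0 ?ltW.
  by rewrite /y; field; rewrite !gt_eqF.
apply: (le_lt_trans le_y); rewrite lt_neqAle.
have y_ge0 i : 0 <= y i by rewrite divr_ge0 ?sqr_ge0 ?ltW.
have yS_ge0 i : 0 <= - (y i * (S *m v) i 0).
  by rewrite oppr_ge0; apply: mulr_ge0_le0 => //; apply: ltW.
apply/andP; split; last first.
  by apply: sumr_le0 => i _; rewrite -oppr_ge0.
apply: contra xN0; rewrite -oppr_eq0 -sumrN => /eqP s0.
apply/eqP/colP => i; rewrite mxE.
have /(_ i isT)/eqP := psumr_eq0P (fun i _ => yS_ge0 i) s0.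
rewrite oppr_eq0 mulf_eq0 (lt_eqF (Sv_lt0 i)) orbF /y mulf_eq0 sqrf_eq0.
by rewrite invr_eq0 (gt_eqF (v_gt0 i)) orbF => /eqP.
Qed.

(** * Hurwitz matrices *)

Lemma eigenvalue_trmx (F : fieldType) (n : nat) (M : 'M[F]_n) (a : F) :
  eigenvalue M^T a = eigenvalue M a.
Proof.
rewrite !eigenvalue_root_char /char_poly -[in LHS]det_tr.
congr (root (\det _) a).
by rewrite /char_poly_mx linearB /= tr_scalar_mx map_trmx trmxK.
Qed.

Lemma Hurwitz_trmx (R : realType) (n : nat) (M : 'M[R]_n) :
  Hurwitz M -> Hurwitz M^T.
Proof. by move=> hM z; rewrite -map_trmx eigenvalue_trmx; apply: hM. Qed.

(** A real root t >= 0 would be an eigenvalue with nonnegative real part, so the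
    monic characteristic polynomial keeps its sign at infinity. *)
Lemma Hurwitz_char_poly_gt0 {R : realType} {n : nat} {M : 'M[R]_n} {t : R} :
  Hurwitz M -> 0 <= t -> 0 < (char_poly M).[t].
Proof.
move=> hM t_ge0.
have noroot s : 0 <= s -> ~~ root (char_poly M) s.
  move=> s_ge0; apply/negP => rs.
  have : eigenvalue (map_mx (real_complex R) M) (real_complex R s).
    by rewrite eigenvalue_root_char -map_char_poly fmorph_root.
  by move/hM => /=; rewrite ltNge s_ge0.
have lc1 : lead_coef (char_poly M) = 1 by apply/monicP/char_poly_monic.
have [|T hT] := @poly_pinfty_gt_lc _ (char_poly M); first by rewrite lc1.
rewrite ltNge; apply/negP => pt_le0.
pose m := Num.max t T.
have pm_gt0 : 0 < (char_poly M).[m].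
  by apply: lt_le_trans (hT m _); rewrite ?lc1 ?ltr01 // le_max lexx orbT.
have tm : t <= m by rewrite le_max lexx.
have [||s /andP[ts _] rs] := @poly_ivt _ (char_poly M) t m => //.
  by rewrite pt_le0 ltW.
by move: (noroot s (le_trans t_ge0 ts)); rewrite rs.
Qed.

(** For an eigenvector u + i v of N with eigenvalue a + i c, the form of
    N^T P + P N takes on u and v values that sum to
    2 a (u^T P u + v^T P v): the contributions of c cancel because P is
    symmetric. *)
Lemma Lyapunov_Hurwitz {R : realType} {n : nat} {P N : 'M[R]_n} :
  posdefmx P -> negdefmx (N^T *m P + P *m N) -> Hurwitz N.
Proof.
move=> [symP posP] [_ negL] z.
(* eigenvalueP yields a row vector, a right eigenvector being its transpose. *)
rewrite -eigenvalue_trmx => /eigenvalueP[w wN wN0].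
pose u : 'cV[R]_n := \col_i complex.Re (w 0 i); pose v : 'cV[R]_n := \col_i complex.Im (w 0 i).
case: z wN => a c wN /=.
have NuvE i : (N *m u) i 0 = a * u i 0 - c * v i 0 /\
              (N *m v) i 0 = c * u i 0 + a * v i 0.
  move/rowP/(_ i): wN; rewrite !mxE.
  have -> : \sum_j w 0 j * (map_mx (real_complex R) N)^T j i =
            Complex (\sum_j N i j * u j 0) (\sum_j N i j * v j 0).
    apply/eqP; rewrite eq_complex !raddf_sum /=; apply/andP; split; apply/eqP;
      apply: eq_bigr => j _; rewrite !mxE; case: (w 0 j) => r s /=; ring.
  case: (w 0 i) => r s /= [-> ->]; split; ring.
have Nu : N *m u = a *: u - c *: v by apply/colP => i; rewrite (NuvE i).1 !mxE.
have Nv : N *m v = c *: u + a *: v by apply/colP => i; rewrite (NuvE i).2 !mxE.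
have uvN0 : (u != 0) || (v != 0).
  apply: contraR wN0; rewrite negb_or !negbK => /andP[/eqP/colP u0 /eqP/colP v0].
  apply/eqP/rowP => i; move: (u0 i) (v0 i); rewrite !mxE.
  by case: (w 0 i) => r s /= -> ->.
have bil (x y : 'cV[R]_n) : (x^T *m P *m y) 0 0 = (y^T *m P *m x) 0 0.
  have -> : x^T *m P *m y = (y^T *m P *m x)^T by rewrite !trmx_mul trmxK symP mulmxA.
  by rewrite mxE.
have lyap (x : 'cV[R]_n) : (x^T *m (N^T *m P + P *m N) *m x) 0 0 =
    2 * (x^T *m P *m (N *m x)) 0 0.
  have addE (X Y : 'M[R]_1) : (X + Y) 0 0 = X 0 0 + Y 0 0 by rewrite mxE.
  rewrite mulmxDr mulmxDl addE.
  have -> : x^T *m (N^T *m P) *m x = (N *m x)^T *m P *m x.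
    by rewrite trmx_mul !mulmxA.
  by rewrite (bil (N *m x) x) !mulmxA; ring.
have key : (u^T *m (N^T *m P + P *m N) *m u) 0 0 +
    (v^T *m (N^T *m P + P *m N) *m v) 0 0 =
    2 * a * ((u^T *m P *m u) 0 0 + (v^T *m P *m v) 0 0).
  rewrite !lyap Nu Nv !mulmxDr !mulmxN -!scalemxAr.
  have E (X Y : 'M[R]_1) (r s : R) : (r *: X + s *: Y) 0 0 = r * X 0 0 + s * Y 0 0.
    by rewrite !mxE.
  rewrite -scaleNr !E (bil v u); ring.
have pos (x : 'cV[R]_n) : 0 <= (x^T *m P *m x) 0 0.
  have [->|/posP/ltW //] := eqVneq x 0; by rewrite mulmx0 mxE.
have neg (x : 'cV[R]_n) : (x^T *m (N^T *m P + P *m N) *m x) 0 0 <= 0.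
  have [->|/negL/ltW //] := eqVneq x 0; by rewrite mulmx0 mxE.
have := pos u; have := pos v; have := neg u; have := neg v; move: key.
by case/orP: uvN0 => [] xN0; have := posP _ xN0; have := negL _ xN0; nra.
Qed.

(** * Positive vectors of Metzler Hurwitz matrices *)

(** The time s is the largest root below T of the product of the p_j, which
    exists since p_i changes sign between t and T.  No p_j changes sign on
    ]s, T[, so every p_j(s) is nonnegative, while one of them vanishes. *)
Lemma exit_time_orthant {R : rcfType} {n : nat} {p : 'I_n -> {poly R}} {t T : R}
    {i : 'I_n} :
    t <= T -> (forall j, 0 < (p j).[T]) -> (p i).[t] <= 0 ->
  exists s, [/\ t <= s, forall j, 0 <= (p j).[s]
                & exists j, (p j).[s] = 0].
Proof.
move=> tT pT_gt0 pit; pose q := \prod_j p j.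
have qT_neq0 : q.[T] != 0.
  by rewrite horner_prod; apply/prodf_neq0 => j _; rewrite gt_eqF.
have rootq j x : root (p j) x -> q.[x] = 0.
  by move=> /eqP r; rewrite horner_prod (bigD1 j) //= r mul0r.
have [||c /andP[tc cT] rc] := @poly_ivt _ (p i) t T => //.
  by rewrite pit ltW.
have {}cT : c < T.
  by rewrite lt_neqAle cT andbT; apply: contraNneq qT_neq0 => <-; rewrite (rootq i).
(* The left end t - 1 leaves room for t itself to be the root found. *)
case: (prev_rootP q (t - 1) T) => [q0|y _ qy0 yI gap|y _ _ gap].
- by rewrite q0 horner0 eqxx in qT_neq0.
- have yT : y < T by rewrite (itvP yI).
  exists y; split.
  + rewrite leNgt; apply/negP => yt.
    suff /gap /negP : c \in `]y, T[ by apply; apply/eqP/(rootq i).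
    by rewrite in_itv /= cT (lt_le_trans yt tc).
  + move=> j; rewrite leNgt; apply/negP => pjy.
    have [||x xI rx] := @poly_ivtoo _ (p j) y T; first exact: ltW.
      by rewrite nmulr_rlt0.
    by move: (gap x xI); rewrite rootE (rootq j x rx) eqxx.
  + move/eqP: qy0; rewrite horner_prod => /prodf_eq0[j _ /eqP pj0].
    by exists j.
have /gap /negP : c \in `](t - 1), T[.
  by rewrite in_itv /= cT andbT (lt_le_trans _ tc) // ltrBlDr ltrDl.
by case; apply/eqP/(rootq i).
Qed.

(** The polynomial vector p = adj (X - N) 1 satisfies
    (t - N) p(t) = d(t) 1, where d is the characteristic polynomial, positive on
    t >= 0.  For large t the matrix t - N is diagonally dominant and p(t) is
    positive.  Decreasing t to 0, p(t) cannot leave the open positive orthant: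
    at the first exit s some p_j(s) = 0 while all other entries are nonnegative,
    and then row j reads d(s) = - \sum_(l != j) N_jl p_l(s) <= 0.  At t = 0 this
    yields p(0) > 0 and N p(0) = - d(0) 1 < 0. *)
Lemma Metzler_Hurwitz_posvec {R : realType} {n : nat} {N : 'M[R]_n} :
    Metzler N -> Hurwitz N ->
  exists v : 'cV[R]_n, (forall i, 0 < v i 0) /\ (forall i, (N *m v) i 0 < 0).
Proof.
move=> metN hurN.
pose p := \adj (char_poly_mx N) *m const_mx 1 : 'cV[{poly R}]_n.
pose d := char_poly N.
have pE t i : t * (p i 0).[t] - \sum_j N i j * (p j 0).[t] = d.[t].
  have /colP/(_ i) : char_poly_mx N *m p = const_mx d.
    rewrite mulmxA mul_mx_adj mul_scalar_mx; apply/colP => j.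
    by rewrite !mxE mulr1.
  rewrite [RHS]mxE => /(congr1 (horner^~ t)) <-.
  have -> : (char_poly_mx N *m p) i 0 =
      'X * p i 0 - \sum_j (N i j)%:P * p j 0.
    rewrite /char_poly_mx mulmxBl mul_scalar_mx; clearbody p.
    by rewrite !mxE; congr (_ - _); apply: eq_bigr => j _; rewrite mxE.
  rewrite !hornerE horner_sum; congr (_ - _); apply: eq_bigr => j _.
  by rewrite !hornerE.
pose T := \sum_i \sum_j `|N i j| + 1.
have T_ge0 : 0 <= T by rewrite addr_ge0 // !sumr_ge0 // => i _; rewrite sumr_ge0.
(* At a smallest entry i of p(T), d(T) <= (T - \sum_l N_il) p_i(T). *)
have pT_gt0 j : 0 < (p j 0).[T].
  have [i _ le_i] := arg_minP (fun i => (p i 0).[T]) (isT : xpredT j).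
  apply: lt_le_trans (le_i j isT).
  have rowT : 0 < T - \sum_l N i l.
    rewrite subr_gt0; apply: le_lt_trans (_ : \sum_i \sum_j `|N i j| < T).
      rewrite [leRHS](bigD1 i) //= ler_wpDr ?ler_sum // => [|l _].
        by rewrite sumr_ge0 // => l _; rewrite sumr_ge0.
      exact: ler_norm.
    by rewrite ltrDl.
  have dT : 0 < d.[T] := Hurwitz_char_poly_gt0 hurN T_ge0.
  rewrite -(pmulr_rgt0 _ rowT); apply: (lt_le_trans dT).
  rewrite -(pE T i) mulrBl lerD2l lerN2 mulr_suml; apply: ler_sum => l _.
  have [->//|il] := eqVneq l i.
  by apply: ler_wpM2l; [apply: metN; rewrite eq_sym | apply: le_i].
have p0_gt0 i : 0 < (p i 0).[0].
  rewrite ltNge; apply/negP => pi0.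
  have [s [s_ge0 ps_ge0 [j pj0]]] :=
    exit_time_orthant (p := fun i => p i 0) T_ge0 pT_gt0 pi0.
  have := Hurwitz_char_poly_gt0 hurN s_ge0; rewrite -/d -(pE s j) pj0 mulr0 sub0r.
  rewrite ltNge oppr_le0 sumr_ge0 // => l _.
  have [->|lj] := eqVneq l j; first by rewrite pj0 mulr0.
  by rewrite mulr_ge0 // metN // eq_sym.
exists (\col_i (p i 0).[0]); split=> i; first by rewrite mxE.
have := Hurwitz_char_poly_gt0 hurN (lexx 0); rewrite -/d -(pE 0 i) mul0r sub0r.
rewrite oppr_gt0 mxE; congr (_ < _); apply: eq_bigr => j _; by rewrite [in RHS]mxE.
Qed.

(** * The Riccati matrix of a rank-one B *)

Lemma Riccati_diag_rank1 {R : realType} {n : nat} (k : 'I_n)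
    (b : 'cV[R]_n) (p q : 'rV[R]_n) :
    (forall i, q 0 i != 0) ->
  let P := diag_mx p in let B : 'M[R]_n := delta_mx k 0 *m b^T in
  P *m B *m invmx (diag_mx q) *m B^T *m P =
  (p 0 k ^+ 2 * \sum_l b l 0 ^+ 2 / q 0 l) *:
    ((delta_mx k 0 : 'cV[R]_n) *m (delta_mx k 0 : 'cV[R]_n)^T).
Proof.
move=> q_neq0 P B; set e : 'cV[R]_n := delta_mx k 0.
have Pe : P *m e = p 0 k *: e := mul_diag_delta p k.
have qinv : invmx (diag_mx q) = diag_mx (\row_j (q 0 j)^-1).
  have qq : diag_mx q *m diag_mx (\row_j (q 0 j)^-1) = 1%:M.
    rewrite mulmx_diag -diag_const_mx; congr diag_mx.
    by apply/rowP => j; rewrite !mxE mulfV.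
  have [uq _] := mulmx1_unit qq.
  by rewrite -[LHS]mulmx1 -qq mulKmx.
have beta : b^T *m invmx (diag_mx q) *m b = (\sum_l b l 0 ^+ 2 / q 0 l)%:M.
  apply/matrixP => i j; rewrite !ord1 qinv mul_mx_diag !mxE.
  by apply: eq_bigr => l _; rewrite !mxE; ring.
have eP : e^T *m P = p 0 k *: e^T.
  by rewrite -[LHS]trmxK trmx_mul trmxK /P tr_diag_mx Pe linearZ.
rewrite /B trmx_mul trmxK !mulmxA Pe -!mulmxA eP.
rewrite -!scalemxAl -!scalemxAr !mulmxA -(mulmxA e) -(mulmxA e) beta.
by rewrite mul_mx_scalar -scalemxAl !scalerA; congr (_ *: _); ring.
Qed.

(** The difference of the two quadratic forms is
    \sum_l (q_l x_l - p_k x_k |b_l|)^2 / q_l. *)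
Lemma diagonally_Riccati_stable_Hurwitz {R : realType} {n : nat} (A : 'M[R]_n)
    (k : 'I_n) (b : 'cV[R]_n) :
  diagonally_Riccati_stable A (delta_mx k 0 *m b^T) ->
  Hurwitz (A + delta_mx k 0 *m (map_mx Num.norm b)^T).
Proof.
set e : 'cV[R]_n := delta_mx k 0; set y := map_mx Num.norm b; set N := A + _.
move=> [P [Q [/diag_mxP[p ->] posP /diag_mxP[q ->]]]].
move=> /diag_posdefmxP q_gt0 [_ negS].
have q_neq0 i : q 0 i != 0 by rewrite gt_eqF.
apply: (Lyapunov_Hurwitz posP); split.
  by rewrite linearD /= !trmx_mul trmxK !tr_diag_mx addrC.
move=> x xN0; have := negS x xN0; rewrite (Riccati_diag_rank1 _ _ _ _ q_neq0).
apply: le_lt_trans.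
have -> : N^T *m diag_mx p + diag_mx p *m N = A^T *m diag_mx p + diag_mx p *m A
    + p 0 k *: (e *m y^T + y *m e^T).
  have pe : diag_mx p *m e = p 0 k *: e := mul_diag_delta p k.
  have ep : e^T *m diag_mx p = p 0 k *: e^T.
    by rewrite -[LHS]trmxK trmx_mul trmxK tr_diag_mx pe linearZ.
  rewrite /N linearD /= trmx_mul trmxK mulmxDl mulmxDr mulmxA pe -mulmxA ep.
  by rewrite -scalemxAl -scalemxAr scalerDr addrACA [p 0 k *: _ + _]addrC.
pose qf (M : 'M[R]_n) := (x^T *m M *m x) 0 0.
have qfD M1 M2 : qf (M1 + M2) = qf M1 + qf M2.
  by rewrite /qf mulmxDr mulmxDl mxE.
have qfZ c M : qf (c *: M) = c * qf M.
  by rewrite /qf -scalemxAr -scalemxAl mxE.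
rewrite -/(qf _) -[leRHS]/(qf _) !qfD -!addrA !lerD2l !qfZ qfD.
rewrite /qf diag_quadform !rank1_quadform delta_trmulE norm_trmulE -subr_ge0.
set c := p 0 k; set xk := x k 0.
rewrite (_ : _ - _ =
  \sum_l (q 0 l * x l 0 - c * xk * `|b l 0|) ^+ 2 / q 0 l).
  by apply: sumr_ge0 => l _; rewrite divr_ge0 ?sqr_ge0 ?ltW.
have -> : c * (xk * (\sum_l `|b l 0| * x l 0) +
    (\sum_l `|b l 0| * x l 0) * xk) = \sum_l 2 * c * xk * (`|b l 0| * x l 0).
  by rewrite -mulr_sumr; ring.
have -> : c ^+ 2 * (\sum_l b l 0 ^+ 2 / q 0 l) * (xk * xk) =
    \sum_l (c * xk) ^+ 2 * (b l 0 ^+ 2 / q 0 l).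
  by rewrite -mulr_sumr; ring.
rewrite -big_split -sumrB; apply: eq_bigr => l _ /=.
rewrite -[b l 0 ^+ 2]real_normK ?num_real //; by field.
Qed.

(** The diagonal certificate is built from positive vectors of N and N^T, with
    Q calibrated so that the arithmetic-geometric mean inequality is tight at
    the positive vector v. *)
Lemma Hurwitz_diagonally_Riccati_stable {R : realType} {n : nat} (A : 'M[R]_n)
    (k : 'I_n) (b : 'cV[R]_n) :
  Metzler A -> Hurwitz (A + delta_mx k 0 *m (map_mx Num.norm b)^T) ->
  diagonally_Riccati_stable A (delta_mx k 0 *m b^T).
Proof.
set e : 'cV[R]_n := delta_mx k 0; set y := map_mx Num.norm b; set N := A + _.
move=> hA hurN.
have eE (i : 'I_n) : e i 0 = (i == k)%:R by rewrite mxE eqxx andbT.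
have colmul (u : 'cV[R]_n) (t : 'M[R]_1) i : (u *m t) i 0 = u i 0 * t 0 0.
  by rewrite mxE big_ord1.
have coladd (u z : 'cV[R]_n) i : (u + z) i 0 = u i 0 + z i 0 by rewrite mxE.
have metN : Metzler N.
  move=> i j ij; rewrite mxE addr_ge0 ?hA // mxE big_ord1 eE !mxE.
  by rewrite mulr_ge0 ?ler0n.
have metNT : Metzler N^T by move=> i j ij; rewrite mxE metN // eq_sym.
have [v [v_gt0 Nv]] := Metzler_Hurwitz_posvec metN hurN.
have [w [w_gt0 Nw]] := Metzler_Hurwitz_posvec metNT (Hurwitz_trmx _ _ _ hurN).
pose p : 'rV[R]_n := \row_i (w i 0 / v i 0).
pose q : 'rV[R]_n := \row_i
  ((if b i 0 == 0 then - (N^T *m w) i 0 else `|b i 0| * w k 0) / v i 0).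
have pE i : p 0 i = w i 0 / v i 0 by rewrite mxE.
have qE i : q 0 i =
  (if b i 0 == 0 then - (N^T *m w) i 0 else `|b i 0| * w k 0) / v i 0.
  by rewrite mxE.
clearbody p q.
have p_gt0 i : 0 < p 0 i by rewrite pE divr_gt0.
have q_gt0 i : 0 < q 0 i.
  rewrite qE divr_gt0 //; case: eqVneq => b0; first by rewrite oppr_gt0.
  by rewrite mulr_gt0 ?normr_gt0.
have q_neq0 i : q 0 i != 0 by rewrite gt_eqF.
have v_neq0 i : v i 0 != 0 by rewrite gt_eqF.
have w_neq0 i : w i 0 != 0 by rewrite gt_eqF.
exists (diag_mx p), (diag_mx q); split.
- exact: diag_mx_is_diag.
- exact/diag_posdefmxP.
- exact: diag_mx_is_diag.
- exact/diag_posdefmxP.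
rewrite (Riccati_diag_rank1 _ _ _ _ q_neq0) -/e.
set c := _ * \sum_l _.
have c_ge0 : 0 <= c.
  by rewrite mulr_ge0 ?sqr_ge0 // sumr_ge0 // => l _; rewrite divr_ge0 ?sqr_ge0 ?ltW.
(* The calibration of Q: c e_k (e_k^T v) = P e_k |b|^T v. *)
have cvk : c * v k 0 = p 0 k * \sum_l `|b l 0| * v l 0.
  rewrite /c expr2 -!mulrA; congr (_ * _); rewrite mulrCA mulr_suml.
  apply: eq_bigr => l _; rewrite qE pE.
  case: eqVneq => [->|bl]; first by rewrite normr0 expr0n !mul0r.
  rewrite -[b l 0 ^+ 2]real_normK ?num_real //.
  by field; rewrite ?v_neq0 ?normr_eq0 ?bl ?w_neq0.
clearbody c; apply: (Metzler_posvec_negdef _ _ v_gt0).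
- rewrite !linearD /= linearZ /= !trmx_mul !trmxK !tr_diag_mx.
  by rewrite [diag_mx p *m A + _]addrC.
- move=> i j ij; rewrite mul_mx_diag mul_diag_mx !mxE big_ord1 (negPf ij) addr0.
  rewrite !addr_ge0 ?mulr_ge0 ?hA ?(ltW (p_gt0 _)) ?mxE ?ler0n //.
  by rewrite eq_sym.
move=> i; have pv : diag_mx p *m v = w.
  by apply/colP => l; rewrite diag_mulE pE divfK.
have -> : ((A^T *m diag_mx p + diag_mx p *m A + diag_mx q + c *: (e *m e^T)) *m v) i 0
   = ((A^T *m w) i 0 + q 0 i * v i 0) + p 0 i * (N *m v) i 0.
  have -> : (N *m v) i 0 = (A *m v) i 0 + e i 0 * \sum_l `|b l 0| * v l 0.
    by rewrite -norm_trmulE mulmxDl -mulmxA coladd colmul.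
  rewrite !mulmxDl -!mulmxA pv -scalemxAl -mulmxA.
  have eev : (e *m (e^T *m v)) i 0 = e i 0 * v k 0.
    by rewrite colmul delta_trmulE.
  have -> (X Y Z W : 'cV[R]_n) : (X + Y + Z + c *: W) i 0 =
     X i 0 + Y i 0 + Z i 0 + c * W i 0 by rewrite !mxE.
  rewrite eev !diag_mulE eE.
  by have [->|_] := eqVneq i k; rewrite ?mul1r ?mul0r ?cvk; ring.
(* If b_i != 0 then (A^T w)_i + q_i v_i = (N^T w)_i < 0; if b_i = 0, it is 0. *)
have -> : (A^T *m w) i 0 = (N^T *m w) i 0 - `|b i 0| * w k 0.
  rewrite linearD /= trmx_mul trmxK mulmxDl -mulmxA coladd.
  by rewrite colmul delta_trmulE [y i 0]mxE addrK.
have Nwi := Nw i; have pNv : p 0 i * (N *m v) i 0 < 0 by rewrite pmulr_rlt0.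
rewrite qE divfK //; case: eqVneq => [->|_]; rewrite ?normr0; lra.
Qed.

Theorem proposition3p2 (R : realType) (n : nat) (A B : 'M[R]_n)
    (k : 'I_n) (b : 'cV[R]_n)
    (hA : Metzler A) (hB : B = delta_mx k 0 *m b^T) :
  diagonally_Riccati_stable A B <-> Hurwitz (hatmx A + barmx B).
Proof.
have -> : hatmx A + barmx B = A + delta_mx k 0 *m (map_mx Num.norm b)^T.
  apply/matrixP => i j; rewrite hB !mxE !big_ord1 !mxE normrM normr_nat.
  congr (_ + _).
  by case: eqVneq => // ij; rewrite ger0_norm //; apply: hA.
rewrite hB; split; first exact: diagonally_Riccati_stable_Hurwitz.
exact: Hurwitz_diagonally_Riccati_stable.
Qed.
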